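(* Let $A\in\mathcal{H}_\alpha(\mathbb{R}^{\mathbb{N}})$, let $z\in\mathbb{R}^{\mathbb{N}}$, and consider the Gibbsian specification $(K_n)_{n\in\mathbb{N}}$ given by $K_n(\varphi,z)=\int_{\mathbb{R}^{\mathbb{N}}}\varphi\,d\mu_n^z$. Suppose there is a sequence of natural numbers $(n_j)_{j \in \mathbb{N}}$ (tending to infinity) such that $\lim_{j\to\infty} \mu^z_{n_j} = \mu^z$ in the weak* topology, for some Borel probability measure $\mu^z$ on $\mathbb{R}^{\mathbb{N}}$. Then for any $\alpha$-Hölder continuous function $\varphi : \mathbb{R}^{\mathbb{N}} \to \mathbb{R}$ and every $n\in\mathbb{N}$, $$\int_{\mathbb{R}^{\mathbb{N}}} \varphi(y)\, d\mu^z(y) = \int_{\mathbb{R}^{\mathbb{N}}} \left(\int_{\mathbb{R}^{\mathbb{N}}} \varphi \, d\mu^{y}_n\right) d\mu^z(y) .$$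
   Context: Points of $\mathbb{R}^{\mathbb{N}}$ are $x=(x_1,x_2,\ldots)$; $\sigma$ is the left shift. The metric on $\mathbb{R}^{\mathbb{N}}$ is $d(x,y)=\sum_{n\ge 1}\frac{1}{\pi 2^n}|\arctan(x_n)-\arctan(y_n)|$; $\mathcal{H}_\alpha(\mathbb{R}^{\mathbb{N}})$ is the set of real-valued $\alpha$-Hölder functions for $d$ (exponent $\alpha\in(0,1]$ fixed). Fix a strictly positive continuous $f:\mathbb{R}\to\mathbb{R}$ with $\int_{\mathbb{R}} f(a)\,da=1$. Write $S_nA(x)=\sum_{k=0}^{n-1}A(\sigma^k(x))$ and $[x|y]_n=(x_1,\ldots,x_n,y_{n+1},y_{n+2},\ldots)$. For $y\in\mathbb{R}^{\mathbb{N}}$, $n\in\mathbb{N}$, $\mu_n^y$ is the Borel probability measure on $\mathbb{R}^{\mathbb{N}}$ with $$\int\varphi\,d\mu_n^y=\frac{1}{Z_n^y}\int_{\mathbb{R}^n}e^{S_nA([x|y]_n)}\varphi([x|y]_n)f(x_1)\cdots f(x_n)\,dx_1\cdots dx_n,$$ $Z_n^y=\int_{\mathbb{R}^n}e^{S_nA([x|y]_n)}f(x_1)\cdots f(x_n)\,dx_1\cdots dx_n$. Weak* convergence of probability measures means convergence of integrals of bounded continuous functions. *)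

(* Defs.v *)
From HB Require Import structures.
From mathcomp Require Import all_boot all_order all_algebra.
From mathcomp Require Import all_classical all_reals all_analysis.
From mathcomp Require Import ring lra.

Set Implicit Arguments.
Unset Strict Implicit.
Unset Printing Implicit Defensive.
Import Order.TTheory GRing.Theory Num.Theory.
Import numFieldNormedType.Exports.

Local Open Scope classical_set_scope.
Local Open Scope ring_scope.

(* Sequences are indexed from 0, so [x i] is the coordinate usually written
   x_(i+1).  [RN R] is an alias of [nat -> R], so that it can carry the metric
   [distRN] and the Borel sets of that metric instead of the structures that
   the library puts on plain function types. *)
Definition RN (R : realType) : Type := nat -> R.

HB.instance Definition _ (R : realType) := Pointed.copy (RN R) (nat -> R).

Definition distRN_term (R : realType) (x y : RN R) (n : nat) : R :=
  (pi * 2 ^+ n.+1)^-1 * `|atan (x n) - atan (y n)|.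

Definition distRN (R : realType) (x y : RN R) : R :=
  limn (series (distRN_term x y)).

Section distRN_metric.
Variable R : realType.
Implicit Types x y z : RN R.

Lemma distRN_term_ge0 x y n : 0 <= distRN_term x y n.
Proof. by rewrite mulr_ge0// invr_ge0 mulr_ge0 ?pi_ge0// exprn_ge0. Qed.

Lemma distRN_term_le x y n : distRN_term x y n <= geometric 2^-1 2^-1 n.
Proof.
rewrite /distRN_term /geometric/= -exprS exprVn invfM [pi^-1 * _]mulrC -mulrA.
rewrite ler_piMr ?invr_ge0 ?exprn_ge0// mulrC ler_pdivrMr ?pi_gt0// mul1r.
have := atan_gtNpi2 (x n); have := atan_gtNpi2 (y n).
have := atan_ltpi2 (x n); have := atan_ltpi2 (y n).
by rewrite ler_norml; lra.
Qed.

Lemma is_cvg_distRN x y : cvgn (series (distRN_term x y)).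
Proof.
apply: (@series_le_cvg _ _ (geometric 2^-1 2^-1)).
- exact: distRN_term_ge0.
- by move=> n; rewrite mulr_ge0// ?invr_ge0// exprn_ge0// invr_ge0.
- exact: distRN_term_le.
- by apply: is_cvg_geometric_series; rewrite ger0_norm ?invr_ge0// invf_lt1// ltr1n.
Qed.

Lemma distRN_term_le_dist x y n : distRN_term x y n <= distRN x y.
Proof.
have nd : nondecreasing_seq (series (distRN_term x y)).
  apply/nondecreasing_seqP => k; rewrite seriesSr lerDl; exact: distRN_term_ge0.
have := nondecreasing_cvgn_le nd (@is_cvg_distRN x y) n.+1.
apply: le_trans; rewrite seriesSr lerDr; apply: sumr_ge0 => k _; exact: distRN_term_ge0.
Qed.

Lemma distRNxx x : distRN x x = 0.
Proof.
rewrite /distRN (_ : series _ = cst 0) ?lim_cst//.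
apply/funext => n; rewrite /series/= big1// => k _.
by rewrite /distRN_term subrr normr0 mulr0.
Qed.

Lemma distRN_positivity x y : distRN x y = 0 -> x = y.
Proof.
move=> d0; apply/funext => n; apply: (can_inj (@atanK R)).
have := distRN_term_le_dist x y n; rewrite d0 => le0.
have /eqP : distRN_term x y n = 0 by apply/eqP; rewrite eq_le le0 distRN_term_ge0.
rewrite mulf_eq0 invr_eq0 mulf_eq0 (gt_eqF (pi_gt0 _)) expf_eq0/= pnatr_eq0/=.
by rewrite normr_eq0 subr_eq0 => /eqP.
Qed.

Lemma distRN_sym x y : distRN x y = distRN y x.
Proof.
rewrite /distRN; congr (limn (series _)); apply/funext => n.
by rewrite /distRN_term distrC.
Qed.

Lemma distRN_triangle y x z : distRN x z <= distRN x y + distRN y z.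
Proof.
rewrite /distRN -lim_seriesD; [|exact: is_cvg_distRN..].
apply: lim_series_le; first exact: is_cvg_distRN.
- by apply: is_cvg_seriesD; exact: is_cvg_distRN.
- move=> n; rewrite /distRN_term /= -[leRHS]mulrDr ler_wpM2l//.
    by rewrite invr_ge0 mulr_ge0 ?pi_ge0// exprn_ge0.
  exact: ler_distD.
Qed.

HB.instance Definition _ := isMetric.Build R (RN R)
  distRNxx distRN_positivity distRN_sym distRN_triangle.

HB.instance Definition _ := @isMeasurable.Build (sigma_display (@open (RN R)))
  (RN R) <<s @open (RN R) >>
  (@sigma_algebra0 _ setT _) (@sigma_algebraC _ _)
  (@sigma_algebra_bigcup _ setT _).

End distRN_metric.

Section lebesgue_tuple.
Variable R : realType.
Local Notation RB := (measurableTypeR R).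

Definition tuple_cons (n : nat) (p : RB * n.-tuple RB) : n.+1.-tuple RB :=
  cons_tuple p.1 p.2.

Lemma measurable_tuple_cons n : measurable_fun setT (@tuple_cons n).
Proof. exact: (measurable_cons measurable_fst measurable_snd). Qed.

Section step.
Local Open Scope ereal_scope.
Variables (n : nat) (m : {sigma_finite_measure set (n.-tuple RB) -> \bar R}).

Definition lebesgue_cons : set (n.+1.-tuple RB) -> \bar R :=
  pushforward (@lebesgue_measure R \x m) (@tuple_cons n).

Let measurable_preimage A : measurable A -> measurable (@tuple_cons n @^-1` A).
Proof. by move=> mA; rewrite -[X in measurable X]setTI; exact: measurable_tuple_cons. Qed.

Let lebesgue_cons0 : lebesgue_cons set0 = 0.
Proof. by rewrite /lebesgue_cons /pushforward preimage_set0 measure0. Qed.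

Let lebesgue_cons_ge0 A : 0 <= lebesgue_cons A.
Proof. by rewrite /lebesgue_cons /pushforward measure_ge0. Qed.

Let lebesgue_cons_sigma_additive : semi_sigma_additive lebesgue_cons.
Proof.
move=> F mF tF mUF; rewrite /lebesgue_cons /pushforward preimage_bigcup.
apply: measure_semi_sigma_additive.
- by move=> k; exact: measurable_preimage.
- apply/trivIsetP => /= i j _ _ ij; rewrite -preimage_setI.
  by move/trivIsetP : tF => /(_ _ _ _ _ ij) ->//; rewrite preimage_set0.
- by rewrite -preimage_bigcup; exact: measurable_preimage.
Qed.

HB.instance Definition _ := isMeasure.Build _ _ _ lebesgue_cons
  lebesgue_cons0 lebesgue_cons_ge0 lebesgue_cons_sigma_additive.

Let lebesgue_cons_sigma_finite : sigma_finite setT lebesgue_cons.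
Proof.
have /sigma_finiteP[F [TF ndF Foo]] := sigma_finiteT (@lebesgue_measure R).
have /sigma_finiteP[G [TG ndG Goo]] := sigma_finiteT m.
pose uncons (t : n.+1.-tuple RB) : (RB * n.-tuple RB)%type :=
  (tnth t ord0, [tuple of behead t]).
have consK : cancel (@tuple_cons n) uncons.
  by move=> [a t]; congr pair; apply: val_inj.
have muncons : measurable_fun setT uncons.
  by apply: measurable_fun_pair; [exact: measurable_tnth|exact: measurable_behead].
exists (fun k => uncons @^-1` (F k `*` G k)).
  rewrite -preimage_bigcup -(preimage_setT uncons); congr (_ @^-1` _).
  rewrite -setXTT TF TG predeqE => -[x y]; split.
    move=> [/= [i _ Fix] [k _ Gky]]; exists (maxn i k) => //; split.
    - by move: x Fix; exact/subsetPset/ndF/leq_maxl.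
    - by move: y Gky; exact/subsetPset/ndG/leq_maxr.
  by move=> [i _ []/= ? ?]; split; exists i.
move=> k; have [? ?] := Foo k; have [? ?] := Goo k; split.
  by rewrite -[X in measurable X]setTI; apply: muncons => //; exact: measurableX.
rewrite /lebesgue_cons /pushforward -comp_preimage.
rewrite (_ : uncons \o _ = idfun) ?preimage_id; last exact/funext.
by rewrite product_measure1E// lte_mul_pinfty// ge0_fin_numE.
Qed.

HB.instance Definition _ := Measure_isSigmaFinite.Build _ _ _ lebesgue_cons
  lebesgue_cons_sigma_finite.

End step.

Fixpoint lebesgue_tuple (n : nat) :
    {sigma_finite_measure set (n.-tuple RB) -> \bar R} :=
  match n with
  | 0 => \d_ [tuple]
  | m.+1 => lebesgue_cons (lebesgue_tuple m)
  end.

End lebesgue_tuple.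

Section definitions.
Variable R : realType.

Definition hoelder_fun (alpha : R) (g : RN R -> R) : Prop :=
  exists C : R, forall x y : RN R, `|g x - g y| <= C * distRN x y `^ alpha.

Definition shiftRN (x : RN R) : RN R := fun i => x i.+1.

Definition birkhoff_sum (A : RN R -> R) (n : nat) (x : RN R) : R :=
  \sum_(0 <= k < n) A (iter k shiftRN x).

Definition splice (n : nat) (x : n.-tuple (measurableTypeR R)) (y : RN R) :
    RN R :=
  fun i => if (i < n)%N then nth 0 x i else y i.

Definition gibbs_weight (A : RN R -> R) (f : R -> R) (n : nat) (y : RN R)
    (x : n.-tuple (measurableTypeR R)) : R :=
  expR (birkhoff_sum A n (splice x y)) * \prod_(i < n) f (tnth x i).

Definition gibbs_Z (A : RN R -> R) (f : R -> R) (n : nat) (y : RN R) : R :=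
  \int[lebesgue_tuple R n]_x gibbs_weight A f y x.

Definition gibbs (A : RN R -> R) (f : R -> R) (n : nat) (y : RN R)
    (B : set (RN R)) : \bar R :=
  ((gibbs_Z A f n y)^-1%:E *
   \int[lebesgue_tuple R n]_(x in [set x | B (splice x y)])
      (gibbs_weight A f y x)%:E)%E.

Definition weak_cvg (nu_ : nat -> set (RN R) -> \bar R)
    (nu : set (RN R) -> \bar R) : Prop :=
  forall g : RN R -> R, continuous g -> (exists M : R, forall x, `|g x| <= M) ->
    (\int[nu_ j]_x (g x)%:E @[j --> \oo] --> \int[nu]_x (g x)%:E)%E.

End definitions.

(* Main.v *)
(* Let [mean n g y] be the integral of g([x|y]_n) f(x_1)...f(x_n) dx.  As f has
   integral 1, averaging first over n coordinates and then over m >= n of them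
   is the same as averaging over m.  Since S_m A splits as S_n A plus a function
   of the coordinates beyond n, this tower property gives the consistency
   mu_m^z (K_n phi) = mu_m^z (phi) of the specification for m >= n.  Both phi and
   K_n phi are alpha-Hoelder for d, hence bounded and continuous, so that the
   identity survives the weak limit along n_j.  Everything is done for phi >= 0
   and transferred to general phi by adding a constant. *)
From HB Require Import structures.
Require Import Defs.
From mathcomp Require Import all_boot all_order all_algebra.
From mathcomp Require Import all_classical all_reals all_analysis.
From mathcomp Require Import measurable_realfun ring lra.

Set Implicit Arguments.
Unset Strict Implicit.
Unset Printing Implicit Defensive.

Import Order.TTheory GRing.Theory Num.Theory.
Import numFieldNormedType.Exports.

Local Open Scope classical_set_scope.
Local Open Scope ring_scope.

(** * The metric on sequence space: estimates, separability, Borel sets *)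

Section distance.
Variable R : realType.
Implicit Types x y w : RN R.

Lemma distRN_ge0 x y : 0 <= distRN x y.
Proof. exact: le_trans (distRN_term_ge0 x y 0) (distRN_term_le_dist x y 0). Qed.

(** The weights halve from one coordinate to the next, so the series reproduces itself after its
    first term. This recursion drives the induction in [distRN_approx] and makes the shift
    Lipschitz. *)
Lemma distRN_shift x y :
  distRN x y = distRN_term x y 0 + 2^-1 * distRN (shiftRN x) (shiftRN y).
Proof.
rewrite /distRN; apply/cvg_lim => //.
rewrite -cvg_shiftS /=.
rewrite (_ : (fun n => _) = (fun n => distRN_term x y 0 +
  2^-1 * series (distRN_term (shiftRN x) (shiftRN y)) n)).
  apply: cvgD; first exact: cvg_cst.
  apply: cvgM; first exact: cvg_cst.
  exact: is_cvg_distRN.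
apply/funext => n; rewrite /series/= big_nat_recl//; congr (_ + _).
rewrite big_distrr/=; apply: eq_bigr => k _.
rewrite /distRN_term mulrA; congr (_ * _).
by rewrite [_ ^+ k.+2]exprS mulrCA invfM.
Qed.

Lemma distRN_shift_le x y : distRN (shiftRN x) (shiftRN y) <= 2 * distRN x y.
Proof.
by rewrite [distRN x y]distRN_shift; have := distRN_term_ge0 x y 0; lra.
Qed.

Lemma distRN_le1 x y : distRN x y <= 1.
Proof.
have c : series (geometric (2^-1 : R) 2^-1) n @[n --> \oo] --> (1 : R).
  have := @cvg_geometric_series R 2^-1 2^-1.
  rewrite (_ : 2^-1 / (1 - 2^-1) = 1); last by field.
  by apply; rewrite ger0_norm ?invr_ge0// invf_lt1// ltr1n.
rewrite -(cvg_lim _ c)//; apply: lim_series_le.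
- exact: is_cvg_distRN.
- exact: cvgP c.
- exact: distRN_term_le.
Qed.

(** The weights on the first [k] coordinates sum to less than 1, and the remaining coordinates
    contribute at most 2^-k in total. *)
Lemma distRN_approx k (e : R) x y :
  (forall i, (i < k)%N -> `|atan (x i) - atan (y i)| <= e) -> 0 <= e ->
  distRN x y <= e + 2^-1 ^+ k.
Proof.
elim: k x y => [|k IH] x y H e0.
  by rewrite expr0 (le_trans (distRN_le1 _ _))// lerDr.
have h1 : distRN (shiftRN x) (shiftRN y) <= e + 2^-1 ^+ k.
  by apply: IH => // i ik; exact: H.
have h0 : distRN_term x y 0 <= 2^-1 * e.
  rewrite /distRN_term expr1 invfM [pi^-1 * _]mulrC -mulrA ler_wpM2l//.
  apply: le_trans (H 0 isT); rewrite ler_piMl// invf_le1 ?pi_gt0//.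
  by have := pi_ge2 R; lra.
rewrite distRN_shift exprS; lra.
Qed.

Lemma ball_RN x (e : R) : ball x e = [set y | distRN x y < e].
Proof. by rewrite ballEmdist. Qed.

(** Separability: finitely many coordinates are approximated through the continuity of [atan], and
    the default value 0 of [nth] fills the others at a cost of at most 2^-k. *)
Lemma distRN_rat w (e : R) : 0 < e ->
  exists q : seq rat, distRN (fun i => ratr (nth 0 q i)) w < e.
Proof.
move=> e0.
have /choice[q qw] i : exists q : rat, `|atan (ratr q) - atan (w i)| < e / 2.
  have : \forall a \near w i, `|atan a - atan (w i)| < e / 2.
    have /cvgrPdist_lt/(_ (e / 2)) := @continuous_atan R (w i).
    rewrite divr_gt0// => /(_ isT); apply: filterS => a; by rewrite distrC.
  move=> /nbhs_ballP[d /= d0 H].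
  have [|q] := @rat_in_itvoo R (w i) (w i + d); first by rewrite ltrDl.
  rewrite in_itv/= => /andP[q1 q2]; exists q; apply: H.
  by rewrite /ball/= ltr_norml; lra.
have [k ke] : exists k, 2^-1 ^+ k < e / 2 :> R.
  have : (2^-1 : R) ^+ n @[n --> \oo] --> (0 : R).
    by apply: cvg_expr; rewrite ger0_norm ?invr_ge0// invf_lt1// ltr1n.
  move=> /cvgrPdist_lt/(_ (e / 2)); rewrite divr_gt0// => /(_ isT)[k _ /(_ k)/=].
  rewrite leqnn sub0r normrN ger0_norm ?exprn_ge0 ?invr_ge0// => /(_ isT) ?.
  by exists k.
exists (mkseq q k).
have : distRN (fun i => ratr (nth 0 (mkseq q k) i)) w <= e / 2 + 2^-1 ^+ k.
  apply: distRN_approx => [i ik|]; last lra.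
  by rewrite nth_mkseq// ltW.
lra.
Qed.

(* Open sets are countable unions of balls around finitely supported rational
   sequences. *)
Lemma measurable_RN d (T : measurableType d) (h : T -> RN R) :
  (forall i, measurable_fun setT (fun t => h t i)) -> measurable_fun setT h.
Proof.
move=> mh; apply: (@measurability _ _ T (RN R) _ _ (@open (RN R))) => //.
move=> _ [U oU <-]; rewrite setTI.
pose pt (q : seq rat) : RN R := fun i => ratr (nth 0 q i).
(* A ball that leaves [U] is replaced by the empty set, so that the union over all indices stays
   inside [U]. *)
pose V (c : seq rat * nat) : set (RN R) :=
  if `[< ball (pt c.1) c.2.+1%:R^-1 `<=` U >] then ball (pt c.1) c.2.+1%:R^-1
  else set0.
have -> : U = \bigcup_c V c.
  apply/seteqP; split => [w Uw|w [c _]]; last first.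
    by rewrite /V; case: ifPn => // /asboolP; apply.
  have /nbhs_ballP[e /= e0 eU] := open_nbhs_nbhs (conj oU Uw).
  (* A ball of radius below [e / 2] that contains [w] lies inside the ball of radius [e] around
     [w]. *)
  have [m me] : exists m, m.+1%:R^-1 < e / 2 :> R.
    have : (0 : R) < e / 2 by lra.
    move=> p; have [m _ /(_ m)/=] := near_infty_natSinv_lt (PosNum p).
    by rewrite leqnn => /(_ isT); exists m.
  have [|q qw] := @distRN_rat w m.+1%:R^-1; first by rewrite invr_gt0.
  exists (q, m) => //; rewrite /V/=; case: asboolP => [_|]; first by rewrite ball_RN.
  case; rewrite ball_RN => v /= qv; apply: eU; rewrite ball_RN/=.
  apply: le_lt_trans (distRN_triangle (pt q) _ _) _.
  rewrite distRN_sym; have := ltrD qw qv; rewrite -/(pt q) /=; move: (distRN _ _ + _) (_^-1) me => a b; lra.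
rewrite preimage_bigcup; apply: countable_bigcupT_measurable => [|c]; first exact: countableP.
rewrite /V; case: ifP => _; last by rewrite preimage_set0.
rewrite ball_RN -[X in measurable X]setTI.
(* The distance is a pointwise limit of partial sums, each involving finitely many coordinates of
   [h]. *)
have mdist : measurable_fun setT (fun t => distRN (pt c.1) (h t)).
  apply: (@measurable_fun_cvg _ _ R setT
    (fun n t => series (distRN_term (pt c.1) (h t)) n)).
    move=> n; rewrite /series/=; apply: measurable_sum => k.
    rewrite /distRN_term; apply: measurable_funM; first exact: measurable_cst.
    apply: measurableT_comp => //; apply: measurable_funB => //.
    apply: (measurableT_comp _ (mh k)); apply: continuous_measurable_fun.
    exact: continuous_atan.
  by move=> t _; exact: is_cvg_distRN.
have := mdist measurableT _ (measurable_itv `]-oo, (c.2.+1%:R^-1 : R)[).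
by congr (measurable (_ `&` _)); apply/seteqP; split => t /=; rewrite in_itv.
Qed.

Lemma continuous_measurable_RN (g : RN R -> R) :
  continuous g -> measurable_fun setT g.
Proof.
move=> /continuousP cg; apply: (measurability _ (RGenOpens.measurableE R)).
move=> _ [_ [a [b ->] <-]]; rewrite setTI; apply: sub_sigma_algebra.
exact/cg/interval_open.
Qed.

(** Composed with [atan], the coordinate is Lipschitz for [distRN], hence measurable; strict
    monotonicity of [atan] carries this over to preimages of rays under the coordinate itself. *)
Lemma measurable_coord i : measurable_fun setT (fun w : RN R => w i).
Proof.
have : measurable_fun setT (fun w : RN R => atan (w i)).
  apply: continuous_measurable_RN => w.
  apply/(@cvgrPdist_lt _ _ _ (nbhs w) (nbhs_filter w)) => e e0.
  pose c : R := pi * 2 ^+ i.+1.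
  have c0 : 0 < c by rewrite mulr_gt0 ?pi_gt0// exprn_gt0.
  apply/nbhs_ballP; exists (e / c) => /=; first exact: divr_gt0.
  move=> v; rewrite ball_RN/= => wv.
  have := le_lt_trans (distRN_term_le_dist w v i) wv.
  by rewrite /distRN_term -/c mulrC ltr_pM2r// invr_gt0.
move=> ma; apply: (measurability _ (RGenOInfty.measurableE R)).
move=> _ [_ [a ->] <-].
have := ma measurableT _ (measurable_itv `]atan a, +oo[).
congr (measurable (_ `&` _)); apply/seteqP; split => w /=; rewrite !in_itv/= !andbT.
  by rewrite !ltNge; apply: contra; exact: le_atan.
exact: lt_atan.
Qed.

End distance.

(** * Stability properties of Hölder functions *)

Section hoelder.
Variables (R : realType) (alpha : R).
Hypothesis alpha_gt0 : 0 < alpha.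
Implicit Types (g h : RN R -> R) (x y : RN R).

Lemma hoelder_const_ge0 g : hoelder_fun alpha g ->
  exists2 C : R, 0 <= C & forall x y, `|g x - g y| <= C * distRN x y `^ alpha.
Proof.
move=> [C gC]; exists `|C| => // x y; apply: le_trans (gC x y) _.
by rewrite ler_wpM2r ?powR_ge0// ler_norm.
Qed.

(** The metric is bounded by 1, so the oscillation of [g] is at most its Hölder constant. *)
Lemma hoelder_bounded g : hoelder_fun alpha g ->
  exists M : R, forall x, `|g x| <= M.
Proof.
move=> /hoelder_const_ge0[C C0 gC]; exists (`|g point| + C) => x.
rewrite -[g x](subrK (g point)) addrC; apply: le_trans (ler_normD _ _) _.
rewrite lerD2l; apply: le_trans (gC x point) _; rewrite ler_piMr//.
apply: (@le_trans _ _ (1 `^ alpha)); last by rewrite powR1.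
rewrite ge0_ler_powR ?nnegrE ?distRN_ge0 ?distRN_le1 ?ler01 ?ltW//.
Qed.

Lemma hoelder_continuous g : hoelder_fun alpha g -> continuous g.
Proof.
move=> /hoelder_const_ge0[C C0 gC] x.
apply/(@cvgrPdist_lt _ _ _ (nbhs x) (nbhs_filter x)) => e e0.
have C1 : 0 < C + 1 by rewrite ltr_wpDl.
(* [d] solves (C + 1) d^alpha = e; [C + 1] stands in for [C], which may vanish. *)
pose d := (e / (C + 1)) `^ alpha^-1.
have d0 : 0 < d by apply: powR_gt0; exact: divr_gt0.
apply/nbhs_ballP; exists d => // y; rewrite ball_RN/= => xy.
apply: le_lt_trans (gC x y) _.
apply: (@le_lt_trans _ _ ((C + 1) * distRN x y `^ alpha)).
  by rewrite ler_wpM2r ?powR_ge0// lerDl.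
rewrite mulrC -ltr_pdivlMr//.
have -> : e / (C + 1) = d `^ alpha.
  by rewrite -powRrM mulVf ?gt_eqF// powRr1// divr_ge0 ?ltW.
by rewrite gt0_ltr_powR ?nnegrE ?distRN_ge0// ltW.
Qed.

Lemma hoelder_measurable g : hoelder_fun alpha g -> measurable_fun setT g.
Proof. by move=> /hoelder_continuous/continuous_measurable_RN. Qed.

Lemma hoelder_emeasurable g : hoelder_fun alpha g -> measurable_fun setT (EFin \o g).
Proof.
by move=> /hoelder_measurable; exact: (measurableT_comp (@EFin_measurable R setT)).
Qed.

Lemma hoelder_cst c : hoelder_fun alpha (fun=> c).
Proof. by exists 0 => x y; rewrite subrr normr0 mul0r. Qed.

Lemma hoelderD g h : hoelder_fun alpha g -> hoelder_fun alpha h ->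
  hoelder_fun alpha (fun x => g x + h x).
Proof.
move=> [C gC] [D hD]; exists (C + D) => x y.
rewrite opprD addrACA mulrDl; apply: le_trans (ler_normD _ _) _.
exact: lerD.
Qed.

Lemma hoelderM g h : hoelder_fun alpha g -> hoelder_fun alpha h ->
  hoelder_fun alpha (fun x => g x * h x).
Proof.
move=> Hg Hh; have [M gM] := hoelder_bounded Hg; have [N hN] := hoelder_bounded Hh.
move: Hg Hh => [C gC] [D hD]; exists (C * N + M * D) => x y.
have -> : g x * h x - g y * h y = (g x - g y) * h x + g y * (h x - h y) by ring.
apply: le_trans (ler_normD _ _) _; rewrite !normrM mulrDl; apply: lerD.
  by rewrite mulrAC; apply: ler_pM.
by rewrite -mulrA; apply: ler_pM.
Qed.

(** [g] is bounded above by some [M], and the exponential is Lipschitz with constant e^M below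
    [M]. *)
Lemma hoelder_expR g : hoelder_fun alpha g -> hoelder_fun alpha (fun x => expR (g x)).
Proof.
move=> Hg; have [M gM] := hoelder_bounded Hg; move: Hg => [C gC].
exists (expR M * C) => x y; rewrite -mulrA.
apply: le_trans (ler_wpM2l (expR_ge0 M) (gC x y)).
have lip (a b : R) : a <= b -> b <= M -> `|expR a - expR b| <= expR M * `|a - b|.
  move=> ab bM; rewrite [`|a - b|]distrC [leLHS]distrC !ger0_norm ?subr_ge0 ?ler_expR//.
  (* Factoring out the larger exponential leaves 1 - e^(-t) <= t with t = b - a. *)
  have -> : expR b - expR a = expR b * (1 - expR (a - b)).
    by rewrite mulrBr mulr1 -expRD [b + _]addrC subrK.
  apply: ler_pM => //; rewrite ?expR_ge0 ?subr_ge0 ?expR_le1 ?subr_le0 ?ler_expR//.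
  by have := expR_ge1Dx (a - b); lra.
have gle z : g z <= M by apply: le_trans (ler_norm _) (gM z).
by have [?|/ltW ?] := leP (g x) (g y); [|rewrite distrC [`|g x - _|]distrC]; exact: lip.
Qed.

Lemma hoelder_inv g (c : R) : 0 < c -> (forall x, c <= g x) ->
  hoelder_fun alpha g -> hoelder_fun alpha (fun x => (g x)^-1).
Proof.
move=> c0 cg [C gC]; exists (C / c ^+ 2) => x y.
have gx0 : 0 < g x := lt_le_trans c0 (cg x).
have gy0 : 0 < g y := lt_le_trans c0 (cg y).
have -> : (g x)^-1 - (g y)^-1 = (g y - g x) / (g x * g y).
  by field; rewrite !gt_eqF.
rewrite normrM distrC mulrAC; apply: ler_pM => //.
rewrite gtr0_norm ?invr_gt0 ?mulr_gt0// lef_pV2 ?posrE ?exprn_gt0 ?mulr_gt0//.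
by rewrite expr2; apply: ler_pM => //; exact: ltW.
Qed.

Lemma hoelder_shift g : hoelder_fun alpha g ->
  hoelder_fun alpha (fun x => g (shiftRN x)).
Proof.
move=> /hoelder_const_ge0[C C0 gC]; exists (C * 2 `^ alpha) => x y.
apply: le_trans (gC _ _) _; rewrite -mulrA ler_wpM2l// -powRM ?distRN_ge0//.
rewrite ge0_ler_powR ?nnegrE ?mulr_ge0 ?distRN_ge0 ?distRN_shift_le ?ltW//.
Qed.

Lemma hoelder_birkhoff g n : hoelder_fun alpha g ->
  hoelder_fun alpha (birkhoff_sum g n).
Proof.
move=> Hg; have Hk k : hoelder_fun alpha (fun x => g (iter k (@shiftRN R) x)).
  elim: k => [//|k IH]; under eq_fun do rewrite iterSr; exact: hoelder_shift IH.
elim: n => [|n IH].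
  rewrite (_ : birkhoff_sum g 0 = fun=> 0); first exact: hoelder_cst.
  by apply/funext => x; rewrite /birkhoff_sum big_geq.
rewrite (_ : birkhoff_sum g n.+1 =
  fun x => birkhoff_sum g n x + g (iter n (@shiftRN R) x)); first exact: hoelderD.
by apply/funext => x; rewrite /birkhoff_sum big_nat_recr.
Qed.

End hoelder.

(** * Prepending a coordinate and overwriting the first coordinates *)

Section cons_splice.
Variable R : realType.
Local Notation RB := (measurableTypeR R).
Implicit Types (w y : RN R).

Definition consRN (a : R) (w : RN R) : RN R :=
  fun i => if i is j.+1 then w j else a.

Lemma shiftRN_cons a w : shiftRN (consRN a w) = w.
Proof. by []. Qed.

(** Matches the recursion of [lebesgue_tuple], in which a new integration variable is put in
    front. *)
Lemma splice_cons n a (x : n.-tuple RB) y :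
  splice (tuple_cons (a, x)) y = consRN a (splice x (shiftRN y)).
Proof. by apply/funext => -[|i]//=; rewrite /splice ltnS. Qed.

Lemma splice0 (x : 0.-tuple RB) y : splice x y = y.
Proof. by apply/funext. Qed.

Lemma splice_splice n (u x : n.-tuple RB) y : splice u (splice x y) = splice u y.
Proof. by apply/funext => i; rewrite /splice; case: (i < n)%N. Qed.

Lemma measurable_splice n : measurable_fun setT
  (fun p : n.-tuple RB * RN R => splice p.1 p.2).
Proof.
apply: measurable_RN => i; have [ni|ni] := ltnP i n.
  rewrite (_ : (fun _ => _) = (@tnth n RB)^~ (Ordinal ni) \o fst).
    exact: (measurableT_comp (measurable_tnth _) measurable_fst).
  by apply/funext => p /=; rewrite /splice ni (tnth_nth 0).
rewrite (_ : (fun _ => _) = (fun w : RN R => w i) \o snd).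
  exact: (measurableT_comp (@measurable_coord R i) measurable_snd).
by apply/funext => p /=; rewrite /splice ltnNge ni.
Qed.

Lemma measurable_splicel n y : measurable_fun setT (fun x : n.-tuple RB => splice x y).
Proof. exact: (measurableT_comp (@measurable_splice n) (pair2_measurable y)). Qed.

Lemma measurable_consRN : measurable_fun setT (fun p : RB * RN R => consRN p.1 p.2).
Proof.
apply: measurable_RN => -[|i]/=; first exact: measurable_fst.
by apply: (measurableT_comp (@measurable_coord R i)); exact: measurable_snd.
Qed.

End cons_splice.

(** * Averages over the first [n] coordinates and their tower property *)

Section mean.
Variables (R : realType) (f : R -> R).
Hypotheses (f_ge0 : forall a, 0 <= f a) (mf : measurable_fun setT f).
Local Notation RB := (measurableTypeR R).
Local Notation leb := (@lebesgue_measure R).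
Hypothesis f_int1 : (\int[leb]_a (f a)%:E = 1)%E.
Implicit Types (g h : RN R -> \bar R) (w y : RN R).
Local Open Scope ereal_scope.

Definition prodf n (x : n.-tuple RB) : R := (\prod_(i < n) f (tnth x i))%R.

Lemma prodf_ge0 n (x : n.-tuple RB) : (0 <= prodf x)%R.
Proof. by apply: prodr_ge0 => i _. Qed.

Lemma prodf_cons n a (x : n.-tuple RB) : prodf (tuple_cons (a, x)) = (f a * prodf x)%R.
Proof.
rewrite /prodf big_ord_recl; congr (f _ * _)%R; apply: eq_bigr => i _.
by rewrite !(tnth_nth 0%R).
Qed.

Lemma measurable_prodf n : measurable_fun setT (@prodf n).
Proof.
apply: measurable_prod => i _; apply: (measurableT_comp mf).
exact: measurable_tnth.
Qed.

(** Extended real values let Tonelli's theorem act on nonnegative integrands without integrability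
    conditions. *)
Definition mean n g y := \int[lebesgue_tuple R n]_x (g (splice x y) * (prodf x)%:E).

Lemma mean_ge0 n g y : (forall w, 0 <= g w) -> 0 <= mean n g y.
Proof.
by move=> g0; apply: integral_ge0 => x _; rewrite mule_ge0// lee_fin prodf_ge0.
Qed.

Let measurable_mean_integrand n g y : measurable_fun setT g ->
  measurable_fun setT (fun x : n.-tuple RB => g (splice x y) * (prodf x)%:E).
Proof.
move=> mg; apply: emeasurable_funM.
  exact: (measurableT_comp mg (measurable_splicel y)).
by apply/measurable_EFinP; exact: measurable_prodf.
Qed.

(** In [mean_mean] the parameter [p.1] is a first coordinate that stays free while the next [n] are
    averaged; joint measurability allows it to be integrated afterwards. *)
Lemma measurable_mean2 d (T : measurableType d) n (G : T * RN R -> \bar R) :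
  measurable_fun setT G -> (forall p, 0 <= G p) ->
  measurable_fun setT (fun p : T * RN R => mean n (fun w => G (p.1, w)) p.2).
Proof.
move=> mG G0.
pose k (q : (T * RN R) * n.-tuple RB) :=
  G (q.1.1, splice q.2 q.1.2) * (prodf q.2)%:E.
apply: (measurable_fun_fubini_tonelli_F (m2 := lebesgue_tuple R n) k).
  apply: emeasurable_funM.
    apply: (measurableT_comp mG); apply: measurable_fun_pair.
      exact: measurableT_comp measurable_fst measurable_fst.
    have swap : measurable_fun setT
        (fun q : (T * RN R) * n.-tuple RB => (q.2, q.1.2)).
      apply: measurable_fun_pair; first exact: measurable_snd.
      exact: measurableT_comp measurable_snd measurable_fst.
    exact: (measurableT_comp (@measurable_splice R n) swap).
  apply/measurable_EFinP; apply: (measurableT_comp (@measurable_prodf n)).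
  exact: measurable_snd.
by move=> q; rewrite mule_ge0// lee_fin prodf_ge0.
Qed.

Lemma measurable_mean n g : measurable_fun setT g -> (forall w, 0 <= g w) ->
  measurable_fun setT (mean n g).
Proof.
move=> mg g0.
have mg2 : measurable_fun setT (fun p : RN R * RN R => g p.2).
  exact: (measurableT_comp mg measurable_snd).
have diag : measurable_fun setT (fun w : RN R => (w, w)).
  by apply: measurable_fun_pair; exact: measurable_id.
exact: (measurableT_comp (measurable_mean2 n mg2 (fun p => g0 p.2)) diag).
Qed.

Lemma mean0 g y : measurable_fun setT g -> mean 0 g y = g y.
Proof.
move=> mg; rewrite /mean/= integral_dirac//; last exact: measurable_mean_integrand.
by rewrite diracT mul1e splice0 /prodf big_ord0 mule1.
Qed.

(** The measure on n+1 coordinates is the image of a product measure, so Tonelli isolates the first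
    coordinate. *)
Lemma meanS n g y : measurable_fun setT g -> (forall w, 0 <= g w) ->
  mean n.+1 g y =
  \int[leb]_a ((f a)%:E * mean n (fun w => g (consRN a w)) (shiftRN y)).
Proof.
move=> mg g0; rewrite /mean/=.
have mtc : measurable_fun setT (@tuple_cons R n) by exact: measurable_tuple_cons.
transitivity (\int[leb \x lebesgue_tuple R n]_p
  (g (consRN p.1 (splice p.2 (shiftRN y))) * (f p.1 * prodf p.2)%:E)).
  rewrite [LHS](ge0_integral_pushforward mtc)//; last 2 first.
  - exact: measurable_mean_integrand.
  - by move=> x _; rewrite mule_ge0// lee_fin prodf_ge0.
  by apply: eq_integral => -[a x] _ /=; rewrite splice_cons prodf_cons.
rewrite fubini_tonelli1//; last 2 first.
- apply: emeasurable_funM.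
    have msplice : measurable_fun setT
        (fun p : RB * n.-tuple RB => (p.1, splice p.2 (shiftRN y))).
      apply: measurable_fun_pair; first exact: measurable_fst.
      exact: (measurableT_comp (measurable_splicel (shiftRN y)) measurable_snd).
    exact: (measurableT_comp mg (measurableT_comp (@measurable_consRN R) msplice)).
  apply/measurable_EFinP; apply: measurable_funM.
    exact: (measurableT_comp mf measurable_fst).
  exact: (measurableT_comp (@measurable_prodf n) measurable_snd).
- by move=> p; rewrite mule_ge0// lee_fin mulr_ge0// prodf_ge0.
apply: eq_integral => a _; rewrite /fubini_F -ge0_integralZl//; last 3 first.
- apply: (@measurable_mean_integrand n (fun w => g (consRN a w))).
  exact: (measurableT_comp mg (measurableT_comp (@measurable_consRN R) (pair1_measurable a))).
- by move=> x _; rewrite mule_ge0// lee_fin prodf_ge0.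
- by rewrite lee_fin.
by apply: eq_integral => x _ /=; rewrite EFinM muleCA.
Qed.

Lemma mean_cst1 n y : mean n (fun=> 1) y = 1.
Proof.
elim: n y => [|n IH] y; first by rewrite mean0.
rewrite meanS//; under eq_integral do rewrite IH mule1.
exact: f_int1.
Qed.

Lemma mean_le n g h y y' : measurable_fun setT g -> measurable_fun setT h ->
  (forall w, 0 <= g w) ->
  (forall x : n.-tuple RB, g (splice x y) <= h (splice x y')) ->
  mean n g y <= mean n h y'.
Proof.
move=> mg mh g0 gh; apply: ge0_le_integral => //.
- by move=> x _; rewrite mule_ge0// lee_fin prodf_ge0.
- exact: measurable_mean_integrand.
- exact: measurable_mean_integrand.
- by move=> x _; rewrite lee_wpmul2r// lee_fin prodf_ge0.
Qed.

Lemma meanD n g h y : measurable_fun setT g -> measurable_fun setT h ->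
  (forall w, 0 <= g w) -> (forall w, 0 <= h w) ->
  mean n (fun w => g w + h w) y = mean n g y + mean n h y.
Proof.
move=> mg mh g0 h0; rewrite /mean -ge0_integralD//; last 4 first.
- by move=> x _; rewrite mule_ge0// lee_fin prodf_ge0.
- exact: measurable_mean_integrand.
- by move=> x _; rewrite mule_ge0// lee_fin prodf_ge0.
- exact: measurable_mean_integrand.
by apply: eq_integral => x _; rewrite ge0_muleDl.
Qed.

(** A factor insensitive to the first [n] coordinates is constant during the integration. *)
Lemma mean_pull n g h y : measurable_fun setT g -> (forall w, 0 <= g w) ->
  0 <= h y -> (forall x : n.-tuple RB, h (splice x y) = h y) ->
  mean n (fun w => h w * g w) y = h y * mean n g y.
Proof.
move=> mg g0 h0 hs; rewrite /mean -ge0_integralZl//; last 2 first.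
- exact: measurable_mean_integrand.
- by move=> x _; rewrite mule_ge0// lee_fin prodf_ge0.
by apply: eq_integral => x _; rewrite hs muleA.
Qed.

Lemma mean_cst n (c : \bar R) y : 0 <= c -> mean n (fun=> c) y = c.
Proof.
move=> c0; transitivity (mean n (fun=> c * 1) y); first by rewrite mule1.
by rewrite (@mean_pull n (fun=> 1) (fun=> c))// mean_cst1 mule1.
Qed.

(* By induction on [n]: the first coordinate is integrated twice on the left, and
   one of the two integrations disappears because [f] has integral 1. *)
Lemma mean_mean n m g y : (n <= m)%N ->
  measurable_fun setT g -> (forall w, 0 <= g w) ->
  mean m (mean n g) y = mean m g y.
Proof.
elim: n m g y => [|n IH] [|m] g y// nm mg g0.
- by rewrite mean0// (_ : mean 0 g = g)//; apply/funext => w; exact: mean0.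
- by rewrite (_ : mean 0 g = g)//; apply/funext => w; exact: mean0.
have mgc : measurable_fun setT (fun p : RB * RN R => g (consRN p.1 p.2)).
  exact: (measurableT_comp mg (@measurable_consRN R)).
pose H (p : RB * RN R) := (f p.1)%:E * mean n (fun w => g (consRN p.1 w)) p.2.
have mH : measurable_fun setT H.
  apply: emeasurable_funM.
    by apply/measurable_EFinP; exact: (measurableT_comp mf measurable_fst).
  exact: (measurable_mean2 n mgc (fun p => g0 _)).
have H0 p : 0 <= H p by rewrite mule_ge0 ?lee_fin// mean_ge0.
have mgS : measurable_fun setT (mean n.+1 g) by exact: measurable_mean.
rewrite !meanS//; last by move=> w; exact: mean_ge0.
(* Averaging overwrites the first coordinate, so [mean n.+1 g] takes the value [K w] at [consRN a w]
   for every [a]. *)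
pose K w := \int[leb]_b H (b, w).
have mK : measurable_fun setT K.
  exact: (measurable_fun_fubini_tonelli_G (m1 := leb) H).
have K0 w : 0 <= K w by apply: integral_ge0.
under eq_integral => a _.
  rewrite (_ : (fun w => _) = K); last first.
    by apply/funext => w; rewrite meanS// shiftRN_cons.
  over.
rewrite ge0_integralZr//; last 3 first.
- exact/measurable_EFinP.
- by move=> a _; rewrite lee_fin.
- exact: mean_ge0.
(* The integral over [a] now carries [f a] alone and contributes the factor 1. *)
rewrite f_int1 mul1e [LHS]/mean.
have mHs : measurable_fun setT (fun p : RB * m.-tuple RB =>
    H (p.1, splice p.2 (shiftRN y)) * (prodf p.2)%:E).
  apply: emeasurable_funM.
    apply: (measurableT_comp mH); apply: measurable_fun_pair => //.
    exact: (measurableT_comp (measurable_splicel _) measurable_snd).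
  apply/measurable_EFinP; exact: (measurableT_comp (@measurable_prodf m) measurable_snd).
transitivity (\int[lebesgue_tuple R m]_x \int[leb]_b
    (H (b, splice x (shiftRN y)) * (prodf x)%:E)).
  apply: eq_integral => x _; rewrite /K ge0_integralZr//.
    exact: (measurableT_comp mH (pair2_measurable _)).
  by rewrite lee_fin prodf_ge0.
(* With [b] moved to the outer integral, the induction hypothesis applies for each fixed [b]. *)
rewrite -(fubini_tonelli (fun p : RB * m.-tuple RB =>
    H (p.1, splice p.2 (shiftRN y)) * (prodf p.2)%:E))//; last first.
  by move=> p; rewrite mule_ge0// lee_fin prodf_ge0.
apply: eq_integral => b _.
rewrite -/(mean m (fun w => H (b, w)) (shiftRN y)).
rewrite -(IH m (fun w => g (consRN b w)))//; last first.
  exact: (measurableT_comp mgc (pair1_measurable b)).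
rewrite (@mean_pull m (mean n (fun w => g (consRN b w))) (fun=> (f b)%:E))//.
- by apply: measurable_mean => //; exact: (measurableT_comp mgc (pair1_measurable b)).
- by move=> w; exact: mean_ge0.
- by rewrite lee_fin.
Qed.

End mean.

(** * Integration against the image of a weighted measure *)

Section pushforward_density.
Context d1 d2 (T1 : measurableType d1) (T2 : measurableType d2) (R : realType).
Variables (mu : {measure set T1 -> \bar R}) (w : T1 -> R) (s : T1 -> T2).
Hypotheses (w_ge0 : forall x, 0 <= w x) (mw : measurable_fun setT w).
Hypothesis ms : measurable_fun setT s.
Local Open Scope ereal_scope.

(** Unnormalised form of [gibbs], where [s] is the splicing map and [w] the Gibbs weight. *)
Definition pushforward_density (B : set T2) : \bar R := \int[mu]_(x in s @^-1` B) (w x)%:E.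

Let measurable_preimage B : measurable B -> measurable (s @^-1` B).
Proof. by move=> mB; rewrite -[X in measurable X]setTI; exact: ms. Qed.

Let density0 : pushforward_density set0 = 0.
Proof. by rewrite /pushforward_density preimage_set0 integral_set0. Qed.

Let density_ge0 B : 0 <= pushforward_density B.
Proof. by apply: integral_ge0 => x _; rewrite lee_fin. Qed.

Let density_sigma_additive : semi_sigma_additive pushforward_density.
Proof.
move=> F mF tF mUF; rewrite /pushforward_density preimage_bigcup.
apply: (@semi_sigma_additive_nng_induced _ _ _ mu (EFin \o w) _ _
  (fun k => s @^-1` F k)).
- exact/measurable_EFinP.
- by move=> x; rewrite lee_fin.
- by move=> k; exact: measurable_preimage.
- apply/trivIsetP => /= i j _ _ ij; rewrite -preimage_setI.
  by move/trivIsetP : tF => /(_ _ _ _ _ ij) ->//; rewrite preimage_set0.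
- by rewrite -preimage_bigcup; exact: measurable_preimage.
Qed.

Definition density_measure : {measure set T2 -> \bar R} :=
  HB.pack pushforward_density (isMeasure.Build _ _ _ pushforward_density
    density0 density_ge0 density_sigma_additive).

Import HBNNSimple.

Let integral_density_nnsfun (h : {nnsfun T2 >-> R}) :
  \int[density_measure]_y (h y)%:E = \int[mu]_x ((h (s x))%:E * (w x)%:E).
Proof.
under eq_integral do rewrite fimfunE -fsumEFin//.
rewrite ge0_integral_fsum//; last 2 first.
- by move=> r; exact/measurable_EFinP/measurableT_comp.
- by move=> r y _; rewrite EFinM nnfun_muleindic_ge0.
under [RHS]eq_integral.
  move=> x _; rewrite fimfunE -fsumEFin// ge0_mule_fsuml; last first.
    by move=> r; rewrite EFinM nnfun_muleindic_ge0.
  over.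
have mind r : measurable_fun setT (fun x => (\1_(h @^-1` [set r]) (s x) : R)%:E * (w x)%:E).
  apply/measurable_EFinP/measurable_funM => //.
  by apply: (measurableT_comp _ ms); exact: measurable_indic.
rewrite ge0_integral_fsum//; last 2 first.
- move=> r; under eq_fun do rewrite EFinM -muleA.
  exact: emeasurable_funM.
- move=> r x _; apply: mule_ge0; last by rewrite lee_fin.
  by rewrite EFinM nnfun_muleindic_ge0.
apply: eq_fsbigr => r _.
rewrite integralZl_indic_nnsfun// integral_indic// setIT.
transitivity (r%:E * \int[mu]_x ((\1_(h @^-1` [set r]) (s x) : R)%:E * (w x)%:E)).
  congr (_ * _); rewrite -[LHS]/(\int[mu]_(x in s @^-1` (h @^-1` [set r])) (w x)%:E).
  rewrite integral_mkcond.
  apply: eq_integral => x _; rewrite patchE indicE.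
  have -> : (x \in s @^-1` (h @^-1` [set r])) = (s x \in h @^-1` [set r]).
    by apply/idP/idP; rewrite !inE.
  by case: ifPn => _; rewrite ?mul1e ?mul0e.
(* A nonnegative simple function has an empty fibre over a negative [r], and both sides then
   vanish. *)
have [r0|r0] := leP 0%R r.
  rewrite -ge0_integralZl//; last by move=> x _; rewrite mule_ge0 ?lee_fin.
  by apply: eq_integral => x _; rewrite EFinM muleA.
rewrite preimage_nnfun0//.
by rewrite !integral0_eq ?mule0// => x _; rewrite indic0 ?mulr0 mul0e.
Qed.

(** Monotone convergence on both sides extends the case of simple functions. *)
Lemma integral_density_measure (g : T2 -> \bar R) : measurable_fun setT g ->
  (forall y, 0 <= g y) ->
  \int[density_measure]_y g y = \int[mu]_x (g (s x) * (w x)%:E).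
Proof.
move=> mg g0; pose g_ := nnsfun_approx measurableT mg.
transitivity (limn (fun n => \int[density_measure]_y (g_ n y)%:E)).
  rewrite -monotone_convergence//.
  - apply: eq_integral => y _; apply/esym/cvg_lim => //.
    exact: cvg_nnsfun_approx.
  - by move=> n; exact/measurable_EFinP.
  - by move=> n y _; rewrite lee_fin.
  - by move=> y _ m n mn; rewrite lee_fin; exact/lefP/nd_nnsfun_approx.
under eq_fun do rewrite integral_density_nnsfun.
rewrite -monotone_convergence//.
- apply: eq_integral => x _; apply/cvg_lim => //; apply: cvgeZr => //.
  exact: cvg_nnsfun_approx.
- move=> n; apply/measurable_EFinP/measurable_funM => //.
  exact: (measurableT_comp _ ms).
- by move=> n x _; rewrite mule_ge0 ?lee_fin.
- move=> x _ m n mn; rewrite lee_wpmul2r ?lee_fin//; exact/lefP/nd_nnsfun_approx.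
Qed.

End pushforward_density.

(** * Shifts, splicing and Birkhoff sums *)

Section shift.
Variable R : realType.
Local Notation RB := (measurableTypeR R).
Implicit Types (w y : RN R) (A : RN R -> R).

Lemma distRN_splice n (x : n.-tuple RB) y y' :
  distRN (splice x y) (splice x y') <= distRN y y'.
Proof.
apply: lim_series_le; [exact: is_cvg_distRN..|] => i.
rewrite /distRN_term /splice; case: ifP => // _.
by rewrite subrr normr0 mulr0 distRN_term_ge0.
Qed.

Lemma iter_shiftRN n w i : iter n (@shiftRN R) w i = w (i + n)%N.
Proof. by elim: n i => [|n IH] i; rewrite ?addn0//= /shiftRN IH addSnnS. Qed.

Lemma iter_shiftRN_splice n (x : n.-tuple RB) y :
  iter n (@shiftRN R) (splice x y) = iter n (@shiftRN R) y.
Proof.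
by apply/funext => i; rewrite !iter_shiftRN /splice ltnNge leq_addl.
Qed.

(** Cocycle identity: the second summand sees only coordinates beyond [n]. *)
Lemma birkhoff_sumD A n k w :
  birkhoff_sum A (n + k) w =
  birkhoff_sum A n w + birkhoff_sum A k (iter n (@shiftRN R) w).
Proof.
rewrite /birkhoff_sum (@big_cat_nat _ _ _ n)//= ?leq_addr//; congr (_ + _).
rewrite -{1}[n]add0n big_addn addKn; apply: eq_bigr => i _.
by rewrite iterD.
Qed.

End shift.

(** * The Gibbsian specification and its consistency *)

Section gibbs.
Variables (R : realType) (alpha : R) (f : R -> R) (A : RN R -> R).
Hypothesis alpha_gt0 : 0 < alpha.
Hypotheses (f_ge0 : forall a, 0 <= f a) (mf : measurable_fun setT f).
Local Notation RB := (measurableTypeR R).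
Hypothesis f_int1 : (\int[@lebesgue_measure R]_a (f a)%:E = 1)%E.
Hypothesis hA : hoelder_fun alpha A.
Implicit Types (g : RN R -> R) (w y : RN R).

(** For nonnegative Hölder [g] the average is finite, so [fine] loses nothing; see [rmeanE]. *)
Definition rmean n g y : R := fine (mean f n (EFin \o g) y).

Lemma rmeanE n g y : hoelder_fun alpha g -> (forall w, 0 <= g w) ->
  (rmean n g y)%:E = mean f n (EFin \o g) y.
Proof.
move=> Hg g0; have [M gM] := hoelder_bounded alpha_gt0 Hg.
have mg := hoelder_emeasurable alpha_gt0 Hg.
rewrite /rmean fineK// ge0_fin_numE; last by apply: mean_ge0 => // w; rewrite lee_fin.
apply: (@le_lt_trans _ _ M%:E); last exact: ltry.
have M0 : 0 <= M by apply: le_trans (gM point).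
rewrite -[leRHS](mean_cst f_ge0 mf f_int1 n y); last by rewrite lee_fin.
by apply: mean_le => // x; rewrite /= lee_fin; apply: le_trans (ler_norm _) (gM _).
Qed.

Lemma rmean_ge n g y c : hoelder_fun alpha g -> 0 <= c -> (forall w, c <= g w) ->
  c <= rmean n g y.
Proof.
move=> Hg c0 cg; have g0 w : 0 <= g w := le_trans c0 (cg w).
have mg := hoelder_emeasurable alpha_gt0 Hg.
rewrite -lee_fin rmeanE// -[leLHS](mean_cst f_ge0 mf f_int1 n y) ?lee_fin//.
by apply: mean_le => // *; rewrite /= lee_fin.
Qed.

(** The Hölder constant of [g] survives: splicing the same tuple into two points does not increase
    their distance, and averaging a constant bound returns it. *)
Lemma hoelder_rmean n g : hoelder_fun alpha g -> (forall w, 0 <= g w) ->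
  hoelder_fun alpha (rmean n g).
Proof.
move=> Hg g0; have mg := hoelder_emeasurable alpha_gt0 Hg.
have [C C0 gC] := hoelder_const_ge0 Hg; exists C.
have half y y' : rmean n g y <= rmean n g y' + C * distRN y y' `^ alpha.
  rewrite -lee_fin EFinD !rmeanE//.
  set c := C * _; have c0 : 0 <= c by rewrite mulr_ge0// powR_ge0.
  rewrite -[X in (_ <= _ + X)%E](mean_cst f_ge0 mf f_int1 n y') ?lee_fin//.
  rewrite -meanD//.
  apply: mean_le => //.
  - exact: emeasurable_funD.
  move=> x; rewrite -EFinD lee_fin -lerBlDl.
  apply: le_trans (ler_norm _) _; apply: le_trans (gC _ _) _.
  rewrite ler_wpM2l// ge0_ler_powR ?nnegrE ?distRN_ge0 ?distRN_splice//.
  exact: ltW.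
move=> y y'; rewrite ler_norml; apply/andP; split.
  by have := half y' y; rewrite distRN_sym; lra.
by have := half y y'; lra.
Qed.

Lemma rmean_splice n g (x : n.-tuple RB) y : rmean n g (splice x y) = rmean n g y.
Proof.
by rewrite /rmean /mean; under eq_integral do rewrite splice_splice.
Qed.

Definition boltzmann n w : R := expR (birkhoff_sum A n w).

Lemma boltzmann_ge0 n w : 0 <= boltzmann n w. Proof. exact: expR_ge0. Qed.

Lemma hoelder_boltzmann n : hoelder_fun alpha (boltzmann n).
Proof. exact/hoelder_expR/hoelder_birkhoff. Qed.

(** Keeps the normalising constants away from 0 uniformly in the boundary condition, as
    [hoelder_inv] demands. *)
Lemma boltzmann_lbound n : exists2 c : R, 0 < c & forall w, c <= boltzmann n w.
Proof.
have [M SM] := hoelder_bounded alpha_gt0 (hoelder_birkhoff alpha_gt0 n hA).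
exists (expR (- M)); first exact: expR_gt0.
by move=> w; rewrite ler_expR; have := SM w; rewrite ler_norml => /andP[].
Qed.

Lemma rmean_boltzmann_gt0 n y : 0 < rmean n (boltzmann n) y.
Proof.
have [c c0 cb] := boltzmann_lbound n; apply: (lt_le_trans c0).
exact: (rmean_ge _ _ (hoelder_boltzmann n) (ltW c0) cb).
Qed.

Lemma gibbs_ZE n y : gibbs_Z A f n y = rmean n (boltzmann n) y.
Proof.
by rewrite /gibbs_Z /Rintegral /rmean /mean; congr fine; apply: eq_integral => x _; rewrite EFinM.
Qed.

Let gibbs_Z_ge0 n y : 0 <= (gibbs_Z A f n y)^-1.
Proof. by rewrite invr_ge0 gibbs_ZE ltW// rmean_boltzmann_gt0. Qed.

Let gibbs_weight_ge0 n y (x : n.-tuple RB) : 0 <= gibbs_weight A f y x.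
Proof. by rewrite mulr_ge0 ?expR_ge0// prodr_ge0. Qed.

Let measurable_gibbs_weight n y :
  measurable_fun setT (@gibbs_weight R A f n y).
Proof.
apply: measurable_funM; last exact: measurable_prodf.
apply: (measurableT_comp (hoelder_measurable alpha_gt0 (hoelder_boltzmann n))).
exact: measurable_splicel.
Qed.

(** [gibbs] is a bare set function; this measure unfolds to it and opens it to integration
    theory. *)
Definition gibbs_measure n y : {measure set (RN R) -> \bar R} :=
  mscale (NngNum (gibbs_Z_ge0 n y)) (density_measure (lebesgue_tuple R n)
    (@gibbs_weight_ge0 n y) (measurable_gibbs_weight y) (measurable_splicel y)).

Lemma integral_gibbs n y (g : RN R -> \bar R) :
  measurable_fun setT g -> (forall w, 0 <= g w)%E ->
  (\int[gibbs A f n y]_w g w = (rmean n (boltzmann n) y)^-1%:E *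
    mean f n (fun w => g w * (boltzmann n w)%:E) y)%E.
Proof.
move=> mg g0; rewrite -[LHS]/(\int[gibbs_measure n y]_w g w)%E.
rewrite ge0_integral_mscale// integral_density_measure//= gibbs_ZE.
by congr (_ * _)%E; apply: eq_integral => x _; rewrite EFinM muleA.
Qed.

(** The function K_n g as a quotient of two averages, a form from which its Hölder regularity
    follows. *)
Definition gibbs_kernel n g y : R :=
  rmean n (fun w => g w * boltzmann n w) y / rmean n (boltzmann n) y.

Lemma integral_gibbs_kernel n g y : hoelder_fun alpha g -> (forall w, 0 <= g w) ->
  (\int[gibbs A f n y]_w (g w)%:E = (gibbs_kernel n g y)%:E)%E.
Proof.
move=> Hg g0; rewrite integral_gibbs//; last exact: (hoelder_emeasurable alpha_gt0 Hg).
rewrite /gibbs_kernel mulrC EFinM rmeanE//.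
  by apply: hoelderM => //; exact: hoelder_boltzmann.
by move=> w; rewrite mulr_ge0// boltzmann_ge0.
Qed.

Lemma gibbs_kernel_ge0 n g y : hoelder_fun alpha g -> (forall w, 0 <= g w) ->
  0 <= gibbs_kernel n g y.
Proof.
move=> Hg g0; rewrite divr_ge0 ?(ltW (rmean_boltzmann_gt0 n y))//.
apply: rmean_ge => //; first by apply: hoelderM => //; exact: hoelder_boltzmann.
by move=> w; rewrite mulr_ge0// boltzmann_ge0.
Qed.

Lemma hoelder_gibbs_kernel n g : hoelder_fun alpha g -> (forall w, 0 <= g w) ->
  hoelder_fun alpha (gibbs_kernel n g).
Proof.
move=> Hg g0; apply: hoelderM => //.
  apply: hoelder_rmean; first by apply: hoelderM => //; exact: hoelder_boltzmann.
  by move=> w; rewrite mulr_ge0// boltzmann_ge0.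
have [c c0 cb] := boltzmann_lbound n.
apply: (hoelder_inv c0).
  by move=> w; exact: (rmean_ge _ _ (hoelder_boltzmann n) (ltW c0) cb).
by apply: hoelder_rmean; [exact: hoelder_boltzmann|exact: boltzmann_ge0].
Qed.

Lemma gibbs_setT n y : gibbs A f n y setT = 1%E.
Proof.
have K1 : gibbs_kernel n (fun=> 1) y = 1.
  rewrite /gibbs_kernel (_ : (fun w => 1 * boltzmann n w) = boltzmann n).
    by rewrite divff// gt_eqF// rmean_boltzmann_gt0.
  by apply/funext => w; rewrite mul1r.
have := @integral_gibbs_kernel n (fun=> 1) y (hoelder_cst alpha 1) (fun=> ler01).
rewrite K1 => <-; transitivity (\int[gibbs_measure n y]_w 1%:E)%E; last by [].
by rewrite integral_cst// mul1e.
Qed.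

(** After the tower property it suffices to compare averages over [n] coordinates, where the kernel
    can be pulled out and its denominator cancels. *)
Lemma gibbs_consistent n m g z : (n <= m)%N ->
  hoelder_fun alpha g -> (forall w, 0 <= g w) ->
  (\int[gibbs A f m z]_w (gibbs_kernel n g w)%:E = \int[gibbs A f m z]_w (g w)%:E)%E.
Proof.
move=> nm Hg g0.
have HK := hoelder_gibbs_kernel n Hg g0.
have K0 w := gibbs_kernel_ge0 n w Hg g0.
have meas h : hoelder_fun alpha h -> measurable_fun setT (EFin \o h).
  exact: (hoelder_emeasurable alpha_gt0).
rewrite !integral_gibbs//; try exact: meas; congr (_ * _)%E.
(* [V] is the factor of [boltzmann m] that depends only on coordinates beyond [n]. *)
pose V w := expR (birkhoff_sum A (m - n) (iter n (@shiftRN R) w)).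
have V0 w : 0 <= V w by exact: expR_ge0.
have Vs (x : n.-tuple RB) w : V (splice x w) = V w.
  by rewrite /V iter_shiftRN_splice.
have bV w : boltzmann m w = V w * boltzmann n w.
  by rewrite /boltzmann -{1}(subnKC nm) birkhoff_sumD expRD mulrC.
have Hb := hoelder_boltzmann.
have mb := meas _ (Hb n).
have key w : mean f n (fun w => (gibbs_kernel n g w)%:E * (boltzmann m w)%:E)%E w =
    mean f n (fun w => (g w)%:E * (boltzmann m w)%:E)%E w.
  transitivity (mean f n (fun w => (gibbs_kernel n g w * V w)%:E * (boltzmann n w)%:E)%E w).
    by congr (mean _ _ _ _); apply/funext => v; rewrite bV -!EFinM mulrA.
  (* What remains under the average is [boltzmann n], whose mean is the denominator of the
     kernel. *)
  rewrite (@mean_pull _ f f_ge0 mf n (EFin \o boltzmann n)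
    (fun w => (gibbs_kernel n g w * V w)%:E))//; last 3 first.
  - by move=> v; rewrite lee_fin boltzmann_ge0.
  - by rewrite lee_fin mulr_ge0.
  - by move=> x; rewrite Vs /gibbs_kernel !rmean_splice.
  rewrite -rmeanE//; last exact: boltzmann_ge0.
  rewrite -EFinM mulrAC /gibbs_kernel divfK ?gt_eqF ?rmean_boltzmann_gt0//.
  rewrite mulrC EFinM rmeanE; last 2 first.
  - exact: hoelderM.
  - by move=> v; rewrite mulr_ge0// boltzmann_ge0.
  (* [V] goes back under the average, now next to [g], and restores [boltzmann m]. *)
  rewrite -(@mean_pull _ f f_ge0 mf n _ (EFin \o V))//; last 4 first.
  - by apply: meas; exact: hoelderM.
  - by move=> v; rewrite lee_fin mulr_ge0// boltzmann_ge0.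
  - by rewrite lee_fin.
  - by move=> x; rewrite /= Vs.
  by congr (mean _ _ _ _); apply/funext => v; rewrite bV /= -!EFinM mulrCA.
have tower h : hoelder_fun alpha h -> (forall w, 0 <= h w) ->
    mean f m (fun w => (h w)%:E * (boltzmann m w)%:E)%E z =
    mean f m (mean f n (fun w => (h w)%:E * (boltzmann m w)%:E)%E) z.
  move=> Hh h0; apply/esym/mean_mean => //.
    by apply: (meas (fun w => h w * boltzmann m w)); exact: hoelderM.
  by move=> w; rewrite -EFinM lee_fin mulr_ge0// boltzmann_ge0.
transitivity (mean f m (mean f n
    (fun w => (gibbs_kernel n g w)%:E * (boltzmann m w)%:E)%E) z).
  exact: tower.
transitivity (mean f m (mean f n (fun w => (g w)%:E * (boltzmann m w)%:E)%E) z).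
  by rewrite (funext key).
exact/esym/tower.
Qed.

End gibbs.

(** * Transfer to signed functions and passage to the weak limit *)

(** Boundedness and total mass 1 give integrability, so the integral is additive; this reduces
    bounded signed functions to nonnegative ones. *)
Lemma integral_shift d (T : measurableType d) (R : realType)
    (nu : {measure set T -> \bar R}) (g : T -> R) (M c : R) :
  nu setT = 1%E -> measurable_fun setT g -> (forall x, `|g x| <= M) ->
  (\int[nu]_x (g x)%:E = \int[nu]_x (g x + c)%:E - c%:E)%E.
Proof.
move=> nu1 mg gM; under [in RHS]eq_integral do rewrite EFinD.
have nuT : (nu setT < +oo)%E by rewrite nu1 ltry.
have bi (h : T -> R) N : measurable_fun setT h -> (forall x, `|h x| <= N) ->
    nu.-integrable setT (EFin \o h).
  move=> mh hN; apply: measurable_bounded_integrable => //; exists N.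
  by split=> [|N' NN' x _ /=]; [exact: num_real|exact: le_trans (hN x) (ltW NN')].
have ig := bi _ _ mg gM.
have ic : nu.-integrable setT (EFin \o cst c) by apply: (bi _ `|c|).
rewrite integralD//= integral_cst// nu1 mule1 addeK//.
Qed.

Unset Implicit Arguments.
Local Open Scope ereal_scope.

Theorem lemma4p2 (R : realType) (alpha : R)
    (halpha : (0 < alpha <= 1)%R)
    (f : R -> R) (f_gt0 : forall a : R, (0 < f a)%R) (f_cont : continuous f)
    (f_int1 : \int[lebesgue_measure]_a (f a)%:E = 1)
    (A : RN R -> R) (hA : hoelder_fun alpha A)
    (z : RN R)
    (n_ : nat -> nat) (n_oo : n_ @ \oo --> \oo)
    (mu : probability (RN R) R)
    (mu_lim : weak_cvg (fun j : nat => gibbs A f (n_ j) z) mu)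
    (phi : RN R -> R) (hphi : hoelder_fun alpha phi)
    (n : nat) :
  \int[mu]_y (phi y)%:E =
  \int[mu]_y (\int[gibbs A f n y]_x (phi x)%:E).
Proof.
have alpha0 : (0 < alpha)%R by case/andP: halpha.
have f0 a : (0 <= f a)%R by exact: ltW.
have mf : measurable_fun setT f by exact: continuous_measurable_fun.
have [M phiM] := hoelder_bounded alpha0 hphi.
pose psi x := (phi x + M)%R.
have hpsi : hoelder_fun alpha psi by apply: hoelderD => //; exact: hoelder_cst.
have psi0 x : (0 <= psi x)%R.
  by rewrite /psi -lerBlDr sub0r; have := phiM x; rewrite ler_norml => /andP[].
pose K := gibbs_kernel f A n psi.
have hK : hoelder_fun alpha K by exact: hoelder_gibbs_kernel.
have eqK : \int[mu]_y (psi y)%:E = \int[mu]_y (K y)%:E.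
  have lim g : hoelder_fun alpha g ->
      \int[gibbs A f (n_ j) z]_x (g x)%:E @[j --> \oo] --> \int[mu]_x (g x)%:E.
    move=> hg; apply: mu_lim; first exact: (hoelder_continuous alpha0 hg).
    exact: (hoelder_bounded alpha0 hg).
  (* By consistency the two sequences of integrals agree once [n <= n_ j], hence so do their
     limits. *)
  apply: (@cvg_unique _ (@ereal_hausdorff R) _ _ _ _ (lim _ hpsi)).
  have n_ge : \forall j \near \oo, (n <= n_ j)%N := n_oo _ (nbhs_infty_ge n).
  apply: cvg_trans (lim _ hK); apply: near_eq_cvg.
  apply: (filterS _ n_ge) => j nj; exact: (gibbs_consistent alpha0 f0 mf f_int1 hA z nj hpsi psi0).
have mphi : measurable_fun setT phi by exact: (hoelder_measurable alpha0 hphi).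
(* Each [gibbs A f n y] has mass 1, so adding [M] to the integrand adds [M] to the integral. *)
have inner y : \int[gibbs A f n y]_x (phi x)%:E = (K y - M)%:E.
  rewrite -[LHS]/(\int[gibbs_measure alpha0 f0 mf f_int1 hA n y]_x (phi x)%:E).
  rewrite (@integral_shift _ _ _ _ _ M M)//; last exact: (gibbs_setT alpha0 f0 mf f_int1 hA).
  by rewrite -/(psi _) EFinB -(integral_gibbs_kernel alpha0 f0 mf f_int1 hA).
under [RHS]eq_integral do rewrite inner.
have hKM := hoelderD hK (hoelder_cst alpha (- M)%R).
have [N KN] : exists N : R, forall x, (`|K x - M| <= N)%R.
  exact: (hoelder_bounded alpha0 hKM).
have mu1 : mu setT = 1 := probability_setT mu.
(* Shifting both sides by [M] turns them into the integrals of [psi] and [K]. *)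
rewrite (integral_shift M mu1 mphi phiM).
rewrite (integral_shift M mu1 (hoelder_measurable alpha0 hKM) KN).
by under [in RHS]eq_integral do rewrite subrK; rewrite -eqK.
Qed.
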